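(* Let $R$ be a left and right noetherian ring and let $n$ be a non-negative integer. If every finitely generated left $R$-module has finite $\infty$-syzygy dimension at most $n$, then $\mathrm{r.fpd}\, R\leq n$, and hence $\bigoplus_{i=0}^n I_i(R)$ is an injective cogenerator for the category of all left $R$-modules.
   Context: $\mathrm{mod}\,R$ is the category of finitely generated left $R$-modules. $M\in\mathrm{mod}\,R$ is an $m$-syzygy module if there is an exact sequence $0\to M\to P_{m-1}\to\cdots\to P_0\to A\to 0$ in $\mathrm{mod}\,R$ with every $P_i$ projective; $M$ is an $\infty$-syzygy module if it is an $m$-syzygy module for every $m\geq 1$. The $\infty$-syzygy dimension of $M\in\mathrm{mod}\,R$ is $\inf\{m\geq 0 : \text{there is an exact sequence } 0\to X_m\to\cdots\to X_1\to X_0\to M\to 0 \text{ in } \mathrm{mod}\,R \text{ with every } X_i \text{ an } \infty\text{-syzygy module}\}$, and is infinity if no such $m$ exists. $\mathrm{r.fpd}\,R=\sup\{\mathrm{pd}\,M : M \text{ a finitely generated right } R\text{-module with } \mathrm{pd}\,M<\infty\}$, where $\mathrm{pd}$ is projective dimension. $I_i(R)$ is the $(i+1)$-th term of the minimal injective resolution $0\to R\to I_0(R)\to I_1(R)\to\cdots$ of $R$ as a left $R$-module. An injective cogenerator is an injective module $X$ such that every left $R$-module embeds in a direct product of copies of $X$. *)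

(* Defs.v *)
From HB Require Import structures.
From mathcomp Require Import all_boot all_order all_algebra.
From mathcomp Require Import boolp classical_sets functions.

Set Implicit Arguments.
Unset Strict Implicit.
Unset Printing Implicit Defensive.

Import GRing.Theory.
Local Open Scope classical_set_scope.
Local Open Scope ring_scope.

(* Everything is stated for left modules [M : lmodType S] over a possibly
   noncommutative ring S.  A right R-module is a left module over the converse
   ring R^c, and R as a left module over itself is R^o. *)

Section Modules.
Variable S : pzRingType.
Implicit Types M A B C P E X : lmodType S.

Definition submodule M (N : set M) : Prop :=
  N 0 /\ forall (a : S) (x y : M), N x -> N y -> N (a *: x + y).

(* The submodules of S^o are the left ideals of S. *)
Definition left_noetherian : Prop :=
  forall N : nat -> set S^o,
    (forall k, submodule (N k)) ->
    (forall k, N k `<=` N k.+1) ->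
    exists k, forall l, (k <= l)%N -> N l `<=` N k.

Definition fin_gen M : Prop :=
  exists (k : nat) (x : 'I_k -> M),
    forall y : M, exists c : 'I_k -> S, y = \sum_(i < k) c i *: x i.

Definition surj A B (f : {linear A -> B}) : Prop :=
  forall y, exists x, f x = y.

(* Exactness at B of A --f--> B --g--> C. *)
Definition exact A B C (f : {linear A -> B}) (g : {linear B -> C}) : Prop :=
  forall y, g y = 0 <-> exists x, f x = y.

Definition projective_module P : Prop :=
  forall A B (g : {linear A -> B}) (f : {linear P -> B}),
    surj g -> exists h : {linear P -> A}, forall x, g (h x) = f x.

Definition injective_module E : Prop :=
  forall A B (i : {linear A -> B}) (f : {linear A -> E}),
    injective i -> exists h : {linear B -> E}, forall x, h (i x) = f x.

(* An exact sequence 0 -> X m -> ... -> X 1 -> X 0 -> M -> 0, continued by zero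
   modules beyond degree m: exactness at X m is then the injectivity of its
   outgoing map. *)
Definition finite_resolution (m : nat) (X : nat -> lmodType S)
    (d : forall i, {linear X i.+1 -> X i}) M (e : {linear X 0%N -> M}) : Prop :=
  [/\ surj e, exact (d 0%N) e, (forall i, exact (d i.+1) (d i)) &
      forall i, (m < i)%N -> forall x : X i, x = 0].

(* [infn_le Q n] is inf {m | Q m} <= n, the infimum of the empty set being
   infinity. *)
Definition infn_le (Q : nat -> Prop) (n : nat) : Prop :=
  exists2 m, (m <= n)%N & Q m.

(* The exact sequence 0 -> M -> P_{m-1} -> ... -> P_0 -> A -> 0 is a finite
   resolution of A of length m, with X i = P_i for i < m and X m identified
   with M. *)
Definition syzygy_module (m : nat) M : Prop :=
  fin_gen M /\
  exists (A : lmodType S) (X : nat -> lmodType S)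
         (d : forall i, {linear X i.+1 -> X i}) (e : {linear X 0%N -> A})
         (phi : {linear M -> X m}),
    [/\ finite_resolution m d e, fin_gen A, bijective phi &
        forall i, (i < m)%N -> fin_gen (X i) /\ projective_module (X i)].

Definition infty_syzygy_module M : Prop :=
  forall m, (1 <= m)%N -> syzygy_module m M.

Definition infty_syzygy_dim_le M (n : nat) : Prop :=
  infn_le (fun m =>
    exists (X : nat -> lmodType S) (d : forall i, {linear X i.+1 -> X i})
           (e : {linear X 0%N -> M}),
      finite_resolution m d e /\
      forall i, (i <= m)%N -> infty_syzygy_module (X i)) n.

Definition pd_le M (n : nat) : Prop :=
  infn_le (fun m =>
    exists (X : nat -> lmodType S) (d : forall i, {linear X i.+1 -> X i})
           (e : {linear X 0%N -> M}),
      finite_resolution m d e /\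
      forall i, (i <= m)%N -> projective_module (X i)) n.

(* The supremum of the finite projective dimensions of finitely generated left
   S-modules is at most n. *)
Definition fpd_le (n : nat) : Prop :=
  forall M, fin_gen M -> (exists m, pd_le M m) -> pd_le M n.

Definition essential M (K : set M) : Prop :=
  forall N : set M, submodule N -> N `&` K `<=` [set 0] -> N `<=` [set 0].

(* 0 -> M -> I 0 -> I 1 -> ... ; minimality says that I 0 is an injective
   envelope of M and I i.+1 one of I i modulo the kernel of d i. *)
Definition minimal_injective_resolution M (I : nat -> lmodType S)
    (e : {linear M -> I 0%N}) (d : forall i, {linear I i -> I i.+1}) : Prop :=
  [/\ forall i, injective_module (I i),
      injective e, exact e (d 0%N), (forall i, exact (d i) (d i.+1)) &
      essential (range e) /\ forall i, essential (range (d i))].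

Fixpoint dsum (I : nat -> lmodType S) (n : nat) : lmodType S :=
  if n is k.+1 then (dsum I k * I k.+1)%type else I 0%N.

(* [T -> X] is the direct product of copies of X indexed by T, with its
   pointwise module structure. *)
Definition injective_cogenerator X : Prop :=
  injective_module X /\
  forall M, exists (T : Type) (f : {linear M -> (T -> X)}), injective f.

End Modules.

Definition right_fpd_le (R : pzRingType) (n : nat) : Prop := @fpd_le R^c n.
Definition right_noetherian (R : pzRingType) : Prop := left_noetherian R^c.

(* Main.v *)
From HB Require Import structures.
Require Import Defs.
From mathcomp Require Import all_boot all_order all_algebra.
From mathcomp Require Import boolp classical_sets functions.
Import Defs GRing.Theory.
Local Open Scope ring_scope.

Set Implicit Arguments.
Unset Strict Implicit.
Unset Printing Implicit Defensive.

(** Why the theorem holds.  Let N be a finitely generated right R-module of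
finite projective dimension and choose a resolution of N by free modules of
finite rank, with matrices A_0, A_1, and so on.  For a left module M, the
complex R^(p_j) (x) M is M^(p_j), on which the matrices act, so Tor_(j+1)(N, M)
vanishes exactly when the columns v over M with A_j v = 0 are the A_(j+1) w;
this is [tor_zero].

The j-th syzygy of N is projective iff A_j is von Neumann regular, that is
A_j Y A_j = A_j for some Y ([regular_pd_le], [pd_le_regular]).  A regular A_k
forces, for all j >= k, A_j to be regular and Tor_(j+1)(N, M) = 0 for every M
([regular_tor_zero]); conversely, if Tor_(n+1)(N, M) = 0 for the finitely
generated M presented by the rows of A_n, then A_n is regular
([exact_regular_mx]).

Since pd N is finite, the Tor of N vanish in high degrees, and an infinity
syzygy module X is an m-th syzygy for arbitrarily large m, so Tor_i(N, X) = 0 for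
all i > 0.  A resolution of length at most n of M by such modules then gives
Tor_i(N, M) = 0 for i > n.  Hence A_n is regular, and pd N <= n.

For the second part, E being the sum of I_0, ..., I_n, it must be seen that a
nonzero element x of a left module M survives under some map from M to some I_j
with j <= n.  Suppose not.  Resolve Rx by free left modules of finite rank.
The maps from Rx to I_0, ..., I_n are all zero, hence the dual complex (the
matrices acting on columns) with coefficients in I_j is exact, even at its left
end, for j <= n, and a diagram chase along R -> I_0 -> I_1 -> ... gives the same
with coefficients in R in degrees up to n (Ext^i(Rx, R) = 0 for i <= n).  So the
dual complex is a projective resolution of length n+1 of its n-th cokernel;
that cokernel has finite projective dimension, therefore at most n, and so the
first map of the dual complex splits ([coresolution_split]).  Dually, the first
map of the resolution of Rx is onto, and x = 0. *)

(** * Quotient modules *)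

Lemma linear_map_ex (S : pzRingType) (A B : lmodType S) (f : A -> B) :
  linear f -> exists g : {linear A -> B}, forall x, g x = f x.
Proof.
move=> lf; pose m := GRing.isLinear.Build S A B *:%R f lf.
by exists (HB.pack_for {linear A -> B} f m).
Qed.

Section Quotient.
Variables (S : pzRingType) (M : lmodType S) (N : set M).
Hypothesis subN : submodule N.

Definition mem_submod : pred M := fun x => `[< N x >].

Lemma mem_submod_closed : zmod_closed mem_submod.
Proof.
case: subN => N0 ND; split; first exact/asboolP.
move=> x y /asboolP Nx /asboolP Ny; apply/asboolP.
by rewrite addrC -scaleN1r; apply: ND.
Qed.

Definition zmod_submod : zmodClosed M :=
  HB.pack_for (zmodClosed M) mem_submod
    (GRing.isZmodClosed.Build M mem_submod mem_submod_closed).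

Definition quot_module := Quotient.quot zmod_submod.

HB.instance Definition _ := GRing.Zmodule.on quot_module.

Definition quot_pi (x : M) : quot_module := \pi_quot_module%qT x.

Lemma quot_pi_eq x y : quot_pi x = quot_pi y <-> N (x - y).
Proof.
split=> [/eqP|h].
  by rewrite -Quotient.idealrBE => /asboolP.
by apply/eqP; rewrite -Quotient.idealrBE; apply/asboolP.
Qed.

Lemma quot_piD x y : quot_pi (x + y) = quot_pi x + quot_pi y.
Proof. by rewrite /quot_pi /= !piE. Qed.

Lemma quot_piK (u : quot_module) : quot_pi (repr u) = u.
Proof. exact: reprK. Qed.

Definition quot_scale (a : S) (u : quot_module) : quot_module :=
  quot_pi (a *: repr u).

Lemma quot_scale_pi a x : quot_scale a (quot_pi x) = quot_pi (a *: x).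
Proof.
apply/quot_pi_eq; rewrite -scalerBr.
have [N0 ND] := subN; rewrite -[_ *: _]addr0; apply: ND => //.
exact/quot_pi_eq/quot_piK.
Qed.

Lemma quot_scaleA a b u :
  quot_scale a (quot_scale b u) = quot_scale (a * b) u.
Proof. by rewrite -(quot_piK u) !quot_scale_pi scalerA. Qed.

Lemma quot_scale1 : left_id 1 quot_scale.
Proof. by move=> u; rewrite -(quot_piK u) quot_scale_pi scale1r. Qed.

Lemma quot_scaleDr : right_distributive quot_scale +%R.
Proof.
move=> a u v; rewrite -(quot_piK u) -(quot_piK v).
by rewrite -quot_piD !quot_scale_pi scalerDr quot_piD.
Qed.

Lemma quot_scaleDl u : {morph quot_scale^~ u : a b / a + b}.
Proof.
by move=> a b; rewrite -(quot_piK u) !quot_scale_pi scalerDl quot_piD.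
Qed.

HB.instance Definition _ := GRing.Zmodule_isLmodule.Build S quot_module
  quot_scaleA quot_scale1 quot_scaleDr quot_scaleDl.

Lemma quotient_ex : exists (Q : lmodType S) (p : {linear M -> Q}),
  surj p /\ forall x, p x = 0 <-> N x.
Proof.
have lin : linear (quot_pi : M -> quot_module).
  by move=> a x y; rewrite quot_piD -quot_scale_pi.
have [p pE] := linear_map_ex lin.
exists quot_module, p; split=> [u|x].
  by exists (repr u); rewrite pE quot_piK.
have p0 : quot_pi 0 = 0 by rewrite -pE linear0.
rewrite pE -p0; split=> [/quot_pi_eq|Nx]; first by rewrite subr0.
by apply/quot_pi_eq; rewrite subr0.
Qed.

End Quotient.

(** * Lifting and extending linear maps *)

Section LinearAlgebra.
Variable S : pzRingType.
Implicit Types A B C K M N P Q X Y E : lmodType S.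

Lemma linear_inj0 A B (f : {linear A -> B}) :
  (forall x, f x = 0 -> x = 0) -> injective f.
Proof.
move=> f0 x y fxy; apply/eqP; rewrite -subr_eq0; apply/eqP/f0.
by rewrite linearB fxy subrr.
Qed.

Lemma ker_submodule A B (f : {linear A -> B}) : submodule (fun x => f x = 0).
Proof.
split=> [|a x y fx fy]; first exact: linear0.
by rewrite linearP fx fy scaler0 addr0.
Qed.

Lemma range_submodule A B (f : {linear A -> B}) :
  submodule (fun y => exists x, f x = y).
Proof.
split=> [|a _ _ [x <-] [y <-]]; first by exists 0; rewrite linear0.
by exists (a *: x + y); rewrite linearP.
Qed.

Lemma factor_surj A B C (e : {linear A -> C}) (f : {linear A -> B}) :
  surj e -> (forall x, e x = 0 -> f x = 0) ->
  exists g : {linear C -> B}, forall x, g (e x) = f x.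
Proof.
move=> /choice[s se] ef.
have fE x y : e x = e y -> f x = f y.
  move=> exy; apply/eqP; rewrite -subr_eq0 -linearB; apply/eqP/ef.
  by rewrite linearB exy subrr.
have lin : linear (f \o s).
  by move=> a x y /=; rewrite -linearP; apply: fE; rewrite linearP !se.
have [g gE] := linear_map_ex lin.
by exists g => x; rewrite gE; apply: fE; rewrite se.
Qed.

(** A modulo the kernel of g is the image of g, and f can be read as a map
into it, along which P lifts. *)
Lemma projective_lift P A B (g : {linear A -> B}) (f : {linear P -> B}) :
  projective_module P -> (forall x, exists y, g y = f x) ->
  exists h : {linear P -> A}, forall x, g (h x) = f x.
Proof.
move=> projP /choice[s gs].
have [Q [p [psurj pE]]] := quotient_ex (ker_submodule g).
have pP x y : g x = g y -> p x = p y.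
  move=> gxy; apply/eqP; rewrite -subr_eq0 -linearB; apply/eqP/pE.
  by rewrite linearB gxy subrr.
have lin : linear (p \o s).
  by move=> a x y /=; rewrite -linearP; apply: pP; rewrite linearP !gs linearP.
have [f' f'E] := linear_map_ex lin.
have [h hE] := projP _ _ p f' psurj.
exists h => x; apply/eqP; rewrite -gs -subr_eq0 -linearB; apply/eqP/pE.
by rewrite linearB hE f'E subrr.
Qed.

(** A modulo the kernel of b embeds in B, and f factors through it. *)
Lemma injective_extend A B E (b : {linear A -> B}) (f : {linear A -> E}) :
  injective_module E -> (forall x, b x = 0 -> f x = 0) ->
  exists h : {linear B -> E}, forall x, h (b x) = f x.
Proof.
move=> injE bf.
have [Q [p [psurj pE]]] := quotient_ex (ker_submodule b).
have [b' b'E] := factor_surj (f := b) psurj (fun x => proj1 (pE x)).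
have [f' f'E] := factor_surj (f := f) psurj (fun x h => bf x (proj1 (pE x) h)).
have b'inj : injective b'.
  apply: linear_inj0 => u; have [x <-] := psurj u.
  by rewrite b'E => /pE.
have [h hE] := injE _ _ b' f' b'inj.
by exists h => x; rewrite -b'E hE f'E.
Qed.

(** * Free modules of finite rank *)

Definition lcomb M p (w : 'I_p -> M) (v : 'I_p -> S^o) : M :=
  \sum_(i < p) (v i : S) *: w i.

Lemma lcomb_is_linear M p (w : 'I_p -> M) : linear (lcomb w).
Proof.
move=> a x y; rewrite /lcomb scaler_sumr -big_split /=; apply: eq_bigr => i _.
by rewrite scalerDl scalerA.
Qed.

HB.instance Definition _ M p (w : 'I_p -> M) :=
  GRing.isLinear.Build S ('I_p -> S^o) M *:%R (lcomb w) (lcomb_is_linear w).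

Definition ebase p (i : 'I_p) : 'I_p -> S^o := fun j => (i == j)%:R.

Lemma lcomb_ebase M p (w : 'I_p -> M) i : lcomb w (ebase i) = w i.
Proof.
rewrite /lcomb (bigD1 i) //= /ebase eqxx scale1r big1 ?addr0 // => j ji.
by rewrite eq_sym (negPf ji) scale0r.
Qed.

Lemma lcomb_id p (v : 'I_p -> S^o) : lcomb (@ebase p) v = v.
Proof.
apply/funext => j; rewrite /lcomb fct_sumE (bigD1 j) //= big1 ?addr0.
  by transitivity ((v j : S) * (j == j)%:R) => //; rewrite eqxx mulr1.
move=> i ij; transitivity ((v i : S) * (i == j)%:R) => //.
by rewrite (negPf ij) mulr0.
Qed.

Lemma linear_lcomb M p (f : {linear ('I_p -> S^o) -> M}) v :
  f v = lcomb (fun i => f (ebase i)) v.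
Proof.
rewrite -[in LHS](lcomb_id v) /lcomb linear_sum; apply: eq_bigr => i _.
exact: linearZ.
Qed.

Lemma free_projective p : projective_module ('I_p -> S^o).
Proof.
move=> A B g f gsurj.
have [w wE] := choice (fun i => gsurj (f (ebase i))).
exists (lcomb w : {linear _ -> _}) => x.
rewrite (linear_lcomb f) /lcomb linear_sum; apply: eq_bigr => i _.
by rewrite linearZ /= wE.
Qed.

Lemma fin_gen_cover M : fin_gen M ->
  exists p (f : {linear ('I_p -> S^o) -> M}), surj f.
Proof.
move=> [k [x xE]]; exists k, (lcomb x : {linear _ -> _}) => y.
by have [c ->] := xE y; exists c.
Qed.

Lemma fin_gen_image M N (f : {linear M -> N}) : surj f -> fin_gen M -> fin_gen N.
Proof.
move=> fs [k [x xE]]; exists k, (fun i => f (x i)) => y.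
have [z <-] := fs y; have [c ->] := xE z; exists c.
by rewrite linear_sum; apply: eq_bigr => i _; rewrite linearZ.
Qed.

Lemma fin_gen_free p : fin_gen ('I_p -> S^o).
Proof. by exists p, (@ebase p) => y; exists y; rewrite -[in LHS](lcomb_id y). Qed.

End LinearAlgebra.

(** * Finite free resolutions over a noetherian ring *)

Section Noetherian.
Variable S : pzRingType.
Implicit Types M N : lmodType S.

Fixpoint span M (s : seq M) (y : M) : Prop :=
  if s is x :: s' then exists a z, span s' z /\ y = a *: x + z else y = 0.

Lemma span_submodule M (s : seq M) : submodule (span s).
Proof.
elim: s => [|x s [s0 sD]]; first by split=> // a x y -> ->; rewrite scaler0 addr0.
split=> [|a _ _ [b [z [sz ->]]] [c [t [st ->]]]].
  by exists 0, 0; rewrite scale0r addr0.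
exists (a * b + c), (a *: z + t); split; first exact: sD.
by rewrite scalerDr scalerDl scalerA addrACA.
Qed.

Lemma span_cat M (s t : seq M) y z :
  span s y -> span t z -> span (s ++ t) (y + z).
Proof.
elim: s y => [|x s IH] y /=; first by move=> ->; rewrite add0r.
move=> [a [u [su ->]]] tz; exists a, (u + z); split; first exact: IH.
by rewrite addrA.
Qed.

Lemma span_cat_sub M (s t : seq M) (K : set M) : submodule K ->
  (forall y, span s y -> K y) -> (forall y, span t y -> K y) ->
  forall y, span (s ++ t) y -> K y.
Proof.
move=> [K0 KD]; elim: s => [|x s IH] //= sK tK y [a [z [stz ->]]].
apply: KD; last first.
  apply: IH stz => // u su; apply: sK; exists 0, u; split=> //.
  by rewrite scale0r add0r.
apply: sK; exists 1, 0; split; first by have [] := span_submodule s.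
by rewrite scale1r addr0.
Qed.

Lemma span_lcomb M (s : seq M) y :
  span s y <-> exists c, lcomb (fun i : 'I_(size s) => s`_i) c = y.
Proof.
elim: s y => [|x s IH] y /=.
  split=> [->|[c <-]]; last by rewrite /lcomb big_ord0.
  by exists 0; rewrite /lcomb big_ord0.
split=> [[a [z [/IH[c <-] ->]]]|[c <-]].
  exists (fun i => if unlift ord0 i is Some j then c j else a).
  rewrite /lcomb big_ord_recl unlift_none /=; congr (_ + _).
  by apply: eq_bigr => i _; rewrite liftK.
exists (c ord0), (lcomb (fun i : 'I_(size s) => s`_i) (fun i => c (lift ord0 i))).
split; first by apply/IH; eexists.
by rewrite /lcomb big_ord_recl.
Qed.

(** Used to lift generators of the ideal of leading coordinates of a submodule
K of a free module to elements of K. *)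
Lemma span_lift M N (f : {linear M -> N}) (K : set M) (t : seq N) :
  submodule K -> (forall a, span t a -> exists2 x, K x & f x = a) ->
  exists t', (forall z, span t' z -> K z) /\
    forall a, span t a -> exists2 z, span t' z & f z = a.
Proof.
move=> [K0 KD]; elim: t => [|x t IH] /= tK.
  exists [::]; split=> [z ->//|a ->]; by exists 0; rewrite ?linear0.
have [|t' [t'K ft']] := IH.
  move=> a ta; apply: tK; exists 0, a; split=> //; by rewrite scale0r add0r.
have [|u Ku fu] := tK x.
  exists 1, 0; split; first by have [] := span_submodule t.
  by rewrite scale1r addr0.
exists (u :: t'); split=> [_ [a [z [/t'K Kz ->]]]|_ [a [z [/ft'[w t'w <-] ->]]]].
  exact: KD.
by exists (a *: u + w); [exists a, w | rewrite linearP fu].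
Qed.

Hypothesis noethS : left_noetherian S.

(** If no finite list generates J, repeatedly adjoining an element of J that is
not yet generated gives a chain of ideals that never stops. *)
Lemma noetherian_ideal (J : set S^o) : submodule J ->
  exists s, forall a, J a <-> span s a.
Proof.
move=> Jsub; have [J0 JD] := Jsub; apply: contrapT => nofg.
have step (s : seq S^o) : exists a, (forall b, span s b -> J b) -> J a /\ ~ span s a.
  have [sJ|nsJ] := pselect (forall b, span s b -> J b); last by exists 0.
  apply: contrapT => noa; apply: nofg; exists s => a; split=> [Ja|]; last exact: sJ.
  by apply: contrapT => nsa; apply: noa; exists a.
have [g gP] := choice step.
pose s k := iter k (fun t => g t :: t) [::].
have sJ k b : span (s k) b -> J b.
  elim: k b => [|k IH] b /=; first by move=> ->.
  by move=> [a [z [/IH Jz ->]]]; apply: JD => //; have [] := gP (s k) IH.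
have sS k : subset (span (s k)) (span (s k.+1)).
  by move=> b sb; exists 0, b; split=> //; rewrite scale0r add0r.
have [k kP] := noethS (fun k => span_submodule (s k)) sS.
have [_] := gP (s k) (sJ k); apply; apply: (kP k.+1) => //.
exists 1, 0; split; first by have [] := span_submodule (s k).
by rewrite scale1r addr0.
Qed.

(** Induction on the number j of coordinates that may be nonzero: the j-th
coordinates of the elements of L form a finitely generated ideal, and the
elements whose j-th coordinate is zero fall under the induction hypothesis. *)
Lemma noetherian_free p (K : set ('I_p -> S^o)) : submodule K ->
  exists s, forall v, K v <-> span s v.
Proof.
suff claim j (L : set ('I_p -> S^o)) : submodule L ->
    (forall v, L v -> forall i : 'I_p, (j <= i)%N -> v i = 0) ->
    exists s, forall v, L v <-> span s v.
  by move=> Ksub; apply: (claim p) => // v _ i; rewrite leqNgt ltn_ord.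
elim: j L => [|j IH] L Lsub Lj; have [L0 LD] := Lsub.
  exists [::] => v; split=> [Lv|->//]; apply/funext => i; exact: Lj.
have [pj|jp] := leqP p j.
  by apply: IH => // v Lv i ji; move: (ltn_ord i); rewrite ltnNge (leq_trans pj).
pose o := Ordinal jp.
have evlin : linear (fun v : 'I_p -> S^o => v o) by [].
have [ev evE] := linear_map_ex evlin.
have [t tP] : exists t, forall a, (exists2 v, L v & ev v = a) <-> span t a.
  apply: noetherian_ideal; split=> [|a _ _ [v Lv <-] [w Lw <-]].
    by exists 0; rewrite ?linear0.
  by exists (a *: v + w); [exact: LD | rewrite linearP].
have [t' [t'L evt']] := span_lift Lsub (fun a => proj2 (tP a)).
have [s sP] : exists s, forall v, (L v /\ ev v = 0) <-> span s v.
  apply: IH => [|v [Lv v0] i].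
    split=> [|a v w [Lv v0] [Lw w0]]; first by rewrite linear0.
    by split; [exact: LD | rewrite linearP v0 w0 scaler0 addr0].
  rewrite leq_eqVlt => /orP[/eqP ij|]; last exact: Lj.
  by rewrite -[RHS]v0 evE; congr (v _); apply: val_inj.
exists (s ++ t') => v; split=> [Lv|]; last first.
  by apply: span_cat_sub => // w /sP[].
have /evt'[z t'z zv] : span t (ev v) by apply/tP; exists v.
rewrite -[v](subrK z); apply: span_cat => //; apply/sP.
rewrite linearB zv subrr; split=> //.
by rewrite addrC -scaleN1r; apply: LD => //; exact: t'L.
Qed.

Lemma free_cover_ker p M (f : {linear ('I_p -> S^o) -> M}) :
  exists q (g : {linear ('I_q -> S^o) -> ('I_p -> S^o)}), exact g f.
Proof.
have [s sP] := noetherian_free (ker_submodule f).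
exists (size s), (lcomb (fun i : 'I_(size s) => s`_i) : {linear _ -> _}) => v.
by split=> [/sP/span_lcomb|/span_lcomb/sP].
Qed.

(** The state of the recursion that builds a resolution: bundling the ranks with
the map makes the source of one differential convertible to the target of the
next, so that no cast along an equality of ranks is needed. *)
Record free_map := FreeMap {
  fm_rk : nat;
  fm_src : nat;
  fm_map : {linear ('I_fm_src -> S^o) -> ('I_fm_rk -> S^o)} }.

Lemma free_resolution p M (f : {linear ('I_p -> S^o) -> M}) :
  exists (r : nat -> nat)
    (d : forall i, {linear ('I_(r i.+1) -> S^o) -> ('I_(r i) -> S^o)})
    (e : {linear ('I_(r 0%N) -> S^o) -> M}),
  [/\ forall y, (exists x, e x = y) <-> (exists x, f x = y),
      exact (d 0%N) e & forall i, exact (d i.+1) (d i)].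
Proof.
have [q [g gf]] := free_cover_ker f.
have step (u : free_map) :
    exists t : {q & {linear ('I_q -> S^o) -> ('I_(fm_src u) -> S^o)}},
      exact (projT2 t) (fm_map u).
  by have [q' [g' g'P]] := free_cover_ker (fm_map u); exists (existT _ q' g').
pose nx u := sval (cid (step u)); have nxP u := svalP (cid (step u)).
pose st k := iter k (fun u => FreeMap (projT2 (nx u))) (FreeMap g).
exists (fun i => fm_rk (st i)), (fun i => fm_map (st i)), f.
by split=> // i; exact: nxP (st i).
Qed.

End Noetherian.

(** * Projective dimension and von Neumann regular differentials *)

Section Resolutions.
Variable S : pzRingType.
Implicit Types A B C K M N P Q : lmodType S.

Definition resolution (X : nat -> lmodType S)
    (d : forall i, {linear X i.+1 -> X i}) M (e : {linear X 0%N -> M}) : Prop :=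
  [/\ surj e, exact (d 0%N) e & forall i, exact (d i.+1) (d i)].

Lemma exact_comp0 A B C (f : {linear A -> B}) (g : {linear B -> C}) x :
  exact f g -> g (f x) = 0.
Proof. by move=> fg; apply/fg; exists x. Qed.

Lemma zero_projective M : (forall x : M, x = 0) -> projective_module M.
Proof.
move=> M0 A B g f _; exists (\0 : {linear M -> A}) => x.
by rewrite (M0 x) !linear0.
Qed.

Lemma free0_eq0 (x : 'I_0 -> S^o) : x = 0.
Proof. by apply/funext => -[]. Qed.

(** Beyond its length a finite resolution consists of zero modules, which are
projective, so projectivity may be asked in all degrees. *)
Lemma pd_leP M n : pd_le M n <->
  exists (X : nat -> lmodType S) (d : forall i, {linear X i.+1 -> X i})
         (e : {linear X 0%N -> M}),
    [/\ resolution d e, forall i, projective_module (X i) &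
        forall i, (n < i)%N -> forall x : X i, x = 0].
Proof.
split=> [[m mn [X [d [e [[es de dd X0] Xp]]]]]|[X [d [e [[es de dd] Xp X0]]]]].
  exists X, d, e; split=> // [i|i ni]; last by apply: X0; exact: leq_ltn_trans ni.
  by have [/Xp|/X0/zero_projective] := leqP i m.
by exists n => //; exists X, d, e.
Qed.

(** Splicing a resolution of K onto 0 -> K -> P -> N -> 0.  Shifting by matching
on the degree keeps all the differentials well typed by conversion. *)
Section Splice.
Variables (K P N : lmodType S) (k : {linear K -> P}) (q : {linear P -> N}).
Variables (X : nat -> lmodType S) (d : forall i, {linear X i.+1 -> X i}).
Variable e : {linear X 0%N -> K}.

Definition splice_obj i : lmodType S := if i is j.+1 then X j else P.

Definition splice_map i : {linear splice_obj i.+1 -> splice_obj i} :=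
  match i with 0%N => (k \o e : {linear X 0%N -> P}) | j.+1 => d j end.

Lemma splice_resolution : injective k -> exact k q -> surj q ->
  resolution d e -> resolution splice_map q.
Proof.
move=> kinj kq qs [es de dd]; split=> // [y|[|i]] /=; last exact: dd.
  split=> [/kq[z <-]|[x <-]]; last exact: exact_comp0.
  by have [x <-] := es z; exists x.
move=> y; rewrite -de; split=> [/= h|/= ->]; last exact: linear0.
by apply: kinj; rewrite linear0.
Qed.

End Splice.

Lemma pd_le_extension K P N (k : {linear K -> P}) (q : {linear P -> N}) n :
  injective k -> exact k q -> surj q -> projective_module P ->
  pd_le K n -> pd_le N n.+1.
Proof.
move=> kinj kq qs Pp /pd_leP[X [d [e [res Xp X0]]]]; apply/pd_leP.
exists (splice_obj P X), (splice_map k d e), q.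
split=> [|[|i] //|[|i] //]; first exact: splice_resolution.
  exact: Xp.
exact: X0.
Qed.

Lemma projective_pd_le0 P : projective_module P -> pd_le P 0.
Proof.
move=> Pp; apply/pd_leP.
pose X i : lmodType S := if i is 0%N then P else ('I_0 -> S^o)%type.
pose d i : {linear X i.+1 -> X i} := \0.
exists X, d, (idfun : {linear P -> P}); split.
- split=> [y|y|[|i] y /=]; first by exists y.
  + by split=> [/= ->|[x <-]] //; exists 0.
  + by split=> // _; exists 0; rewrite [RHS]free0_eq0.
  + by split=> // _; exists 0; rewrite [RHS]free0_eq0.
- by case=> [|i] //; exact: free_projective.
- by case=> [|i] // _ x; exact: free0_eq0.
Qed.

(** K is the first syzygy of N, presented as X 1 modulo the kernel of d 0. *)
Lemma resolution_tail (X : nat -> lmodType S)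
    (d : forall i, {linear X i.+1 -> X i}) N (e : {linear X 0%N -> N}) :
  resolution d e ->
  exists K (k : {linear K -> X 0%N}) (e' : {linear X 1%N -> K}),
    [/\ injective k, exact k e, forall x, k (e' x) = d 0%N x &
        @resolution (fun i => X i.+1) (fun i => d i.+1) K e'].
Proof.
move=> [es de dd].
have [K [e' [e's e'E]]] := quotient_ex (ker_submodule (d 0%N)).
have [k kE] := factor_surj (f := d 0%N) e's (fun x => proj1 (e'E x)).
exists K, k, e'; split=> //.
- by apply: linear_inj0 => u; have [x <-] := e's u; rewrite kE => /e'E.
- move=> y; rewrite de; split=> [[x <-]|[u <-]]; first by exists (e' x).
  by have [x <-] := e's u; exists x.
- by split=> // y; rewrite e'E; exact: dd.
Qed.

(** Von Neumann regularity.  For a map of a projective resolution it says that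
its cokernel, a syzygy of the resolved module, is projective. *)
Definition regular_map A B (f : {linear A -> B}) : Prop :=
  exists g : {linear B -> A}, forall x, f (g (f x)) = f x.

(** The map x - d (g x) vanishes on the image of d, hence factors through e and
gives a section of e: N is a retract of P. *)
Lemma regular_projective A P N (d : {linear A -> P}) (e : {linear P -> N}) :
  surj e -> exact d e -> projective_module P -> regular_map d ->
  projective_module N.
Proof.
move=> es de Pp [g gP].
have [s sE] : exists s : {linear N -> P}, forall x, s (e x) = x - d (g x).
  apply: (factor_surj (f := (idfun \- (d \o g) : {linear P -> P}))) => // x.
  by move=> /de[y <-] /=; rewrite gP subrr.
have es' y : e (s y) = y.
  by have [x <-] := es y; rewrite sE linearB (exact_comp0 _ de) subr0.
move=> B C u f us; have [h hE] := Pp _ _ u (f \o e) us.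
by exists (h \o s) => x /=; rewrite hE /= es'.
Qed.

Lemma regular_pd_le (X : nat -> lmodType S)
    (d : forall i, {linear X i.+1 -> X i}) N (e : {linear X 0%N -> N}) n :
  resolution d e -> (forall i, projective_module (X i)) ->
  regular_map (d n) -> pd_le N n.
Proof.
elim: n X d N e => [|n IH] X d N e res Xp dreg; have [es de dd] := res.
  exact/projective_pd_le0/(regular_projective es de).
have [K [k [e' [kinj ke _ res']]]] := resolution_tail res.
apply: (pd_le_extension kinj ke es (Xp _)).
exact: (IH _ _ _ _ res' (fun i => Xp i.+1)).
Qed.

(** A form of Schanuel's lemma.  Compare the resolution X with a resolution Q of
length n by chain maps f : X -> Q and g : Q -> X over the identity of N; then
g f is homotopic to the identity.  In degree n the module Q (n.+1) is zero, so f
kills the image of d n, and the homotopy s gives d n = - d n s d n.  The map h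
stands for the part of the homotopy coming from degree n - 1; only that it
kills the image of d n matters, and this allows a uniform induction.  The last two
clauses say that f and g can be lifted one degree further. *)
Lemma pd_le_regular (X : nat -> lmodType S)
    (d : forall i, {linear X i.+1 -> X i}) N (e : {linear X 0%N -> N}) n :
  resolution d e -> (forall i, projective_module (X i)) ->
  pd_le N n -> regular_map (d n).
Proof.
move=> [es de dd] Xp /pd_leP[Q [dQ [eQ [[eQs deQ ddQ] Qp Q0]]]].
have [f [g [s [h [fgE hd fd gd]]]]] :
    exists (f : {linear X n -> Q n}) (g : {linear Q n -> X n})
      (s : {linear X n -> X n.+1}) (h : {linear X n -> X n}),
    [/\ forall x, g (f x) = x + d n (s x) + h x,
        forall x, h (d n x) = 0,
        forall x, exists y, dQ n y = f (d n x) &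
        forall y, exists x, d n x = g (dQ n y)].
  elim: n {Q0} => [|n [f [g [s [h [fgE hd fd gd]]]]]].
    have [f fE] := Xp 0%N _ _ eQ e eQs.
    have [g gE] := Qp 0%N _ _ e eQ es.
    have [|s sE] := @projective_lift _ _ _ _ (d 0%N) ((g \o f) \- idfun) (Xp 0%N).
      by move=> x; apply/de; rewrite /= linearB /= gE fE subrr.
    exists f, g, s, \0; split=> // [x|x|y].
    - by rewrite sE /= addr0 addrC subrK.
    - by apply/deQ; rewrite fE; exact: exact_comp0.
    - by apply/de; rewrite gE; exact: exact_comp0.
  have [f' f'E] := projective_lift (f := f \o d n) (Xp n.+1) fd.
  have [g' g'E] := projective_lift (f := g \o dQ n) (Qp n.+1) gd.
  (* With h := s d n, the map g' f' - id - h has its image in the kernel of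
     d n, by the identity for g f. *)
  have [|s' s'E] := @projective_lift _ _ _ _ (d n.+1)
      (((g' \o f') \- idfun) \- (s \o d n)) (Xp n.+1).
    move=> x; apply/dd; rewrite /= !linearB /= g'E /= f'E /= fgE hd addr0.
    by rewrite addrAC addrK subrr.
  exists f', g', s', (s \o d n); split=> [x|x|x|y].
  - by rewrite s'E /= -addrA subrK addrC subrK.
  - by rewrite /= (exact_comp0 _ (dd n)) linear0.
  - by apply/ddQ; rewrite f'E /= (exact_comp0 _ (dd n)) linear0.
  - by apply/dd; rewrite g'E /= (exact_comp0 _ (ddQ n)) linear0.
exists (\- s : {linear _ -> _}) => x /=.
have [y fy] := fd x.
have: g (f (d n x)) = 0 by rewrite -fy (Q0 n.+1 _ y) // !linear0.
rewrite fgE hd addr0 => /eqP; rewrite addr_eq0 => /eqP {2}->.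
by rewrite linearN.
Qed.

(** Splice a free resolution of K onto P: its (n+1)-st differential is the n-th
differential of the resolution of K. *)
Lemma pd_le_kernel K P N (k : {linear K -> P}) (q : {linear P -> N}) n :
  left_noetherian S -> fin_gen K -> projective_module P ->
  injective k -> exact k q -> surj q -> pd_le N n.+1 -> pd_le K n.
Proof.
move=> noethS /fin_gen_cover[p [f fs]] Pp kinj kq qs pdN.
have [r [d [e [ef de dd]]]] := free_resolution noethS f.
have res : @resolution (fun i => 'I_(r i) -> S^o)%type d K e.
  by split=> // y; apply/ef.
have Xp i : projective_module ('I_(r i) -> S^o) by exact: free_projective.
apply: (regular_pd_le res Xp).
apply: (pd_le_regular (splice_resolution kinj kq qs res) _ pdN).
by case.
Qed.

End Resolutions.

(** * Matrices acting on columns of module elements *)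

Lemma fct_subE (T : Type) (M : zmodType) (f g : T -> M) x :
  (f - g) x = f x - g x.
Proof. by []. Qed.

Section MatrixAction.
Variable R : pzRingType.
Implicit Types C K M N P X : lmodType R.

Definition mact M p q (A : 'M[R]_(p, q)) (v : 'I_q -> M) : 'I_p -> M :=
  fun i => \sum_j A i j *: v j.

Lemma mactM M p q r (A : 'M[R]_(p, q)) (B : 'M[R]_(q, r)) (v : 'I_r -> M) :
  mact (A *m B) v = mact A (mact B v).
Proof.
apply/funext => i; rewrite /mact.
under eq_bigr => k _ do rewrite mxE scaler_suml.
under [RHS]eq_bigr => j _ do rewrite scaler_sumr.
rewrite exchange_big; apply: eq_bigr => j _; apply: eq_bigr => k _.
by rewrite scalerA.
Qed.

Lemma mact1 M p (v : 'I_p -> M) : mact 1%:M v = v.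
Proof.
apply/funext => i; rewrite /mact (bigD1 i) //= big1 => [|j ij].
  by rewrite mxE eqxx scale1r addr0.
by rewrite mxE eq_sym (negPf ij) scale0r.
Qed.

Lemma mact0 M p q (v : 'I_q -> M) : mact (0 : 'M[R]_(p, q)) v = 0.
Proof. by apply/funext => i; rewrite /mact big1 // => j _; rewrite mxE scale0r. Qed.

Lemma mactBl M p q (A B : 'M[R]_(p, q)) (v : 'I_q -> M) :
  mact (A - B) v = mact A v - mact B v.
Proof.
apply/funext => i; rewrite fct_subE /mact -sumrB; apply: eq_bigr => j _.
by rewrite !mxE scalerBl.
Qed.

Lemma mactBr M p q (A : 'M[R]_(p, q)) (v w : 'I_q -> M) :
  mact A (v - w) = mact A v - mact A w.
Proof.
apply/funext => i; rewrite fct_subE /mact -sumrB; apply: eq_bigr => j _.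
by rewrite scalerBr.
Qed.

Lemma mact_at0 M p q (A : 'M[R]_(p, q)) : mact A (0 : 'I_q -> M) = 0.
Proof. by rewrite -[0 in LHS](subrr 0) mactBr subrr. Qed.

Lemma mact_comp M N p q (f : {linear M -> N}) (A : 'M[R]_(p, q)) v :
  mact A (f \o v) = f \o mact A v.
Proof.
apply/funext => i; rewrite /mact /= linear_sum; apply: eq_bigr => j _.
by rewrite linearZ.
Qed.

Lemma comp_eq0 M N p (f : {linear M -> N}) (v : 'I_p -> M) :
  v = 0 -> f \o v = 0.
Proof. by move=> ->; apply/funext => i; exact: linear0. Qed.

Lemma comp_inj0 M N p (f : {linear M -> N}) (v : 'I_p -> M) :
  injective f -> f \o v = 0 -> v = 0.
Proof.
move=> finj /funeqP fv; apply/funext => i; apply: finj.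
by rewrite linear0; exact: fv.
Qed.

Lemma comp_surj M N p (f : {linear M -> N}) (v : 'I_p -> N) :
  surj f -> exists w : 'I_p -> M, f \o w = v.
Proof.
by move=> fs; have [w wE] := choice (fun i => fs (v i)); exists w; apply/funext.
Qed.

Lemma comp_exact M N P p (f : {linear M -> N}) (g : {linear N -> P})
    (v : 'I_p -> N) : exact f g -> g \o v = 0 -> exists w, f \o w = v.
Proof.
move=> fg /funeqP gv.
have [w wE] := choice (fun i => proj1 (fg (v i)) (gv i)).
by exists w; apply/funext.
Qed.

(** Exactness at the middle term of M^r -> M^q -> M^p.  This one notion serves
twice: for a resolution of a right module it says that a Tor vanishes, and for
the dual of a resolution of a left module that an Ext vanishes. *)
Definition mx_exact M p q r (A : 'M[R]_(p, q)) (B : 'M[R]_(q, r)) : Prop :=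
  forall v : 'I_q -> M, mact A v = 0 -> exists w, mact B w = v.

Lemma mx_exact_mul p q r s (A : 'M[R]_(p, q)) (B : 'M[R]_(q, r))
    (V : 'M[R]_(q, s)) :
  mx_exact R^o A B -> A *m V = 0 -> exists W, V = B *m W.
Proof.
move=> exAB AV0.
have /choice[w wE] j : exists w : 'I_r -> R^o, mact B w = fun i => V i j.
  apply: exAB; apply/funext => i.
  by have := congr1 (fun U : 'M_(p, s) => U i j) AV0; rewrite !mxE.
exists (\matrix_(k, j) w j k); apply/matrixP => i j; rewrite mxE.
have /funeqP/(_ i) <- := wE j; apply: eq_bigr => k _.
by rewrite mxE.
Qed.

Definition regular_mx p q (A : 'M[R]_(p, q)) : Prop :=
  exists Y, A *m Y *m A = A.

(** The columns of 1 - Y A are killed by A, so 1 - Y A = B W: this makes B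
regular, and rewrites any v with A v = 0 as B (W v). *)
Lemma regular_mx_exact p q r (A : 'M[R]_(p, q)) (B : 'M[R]_(q, r)) :
  A *m B = 0 -> mx_exact R^o A B -> regular_mx A ->
  regular_mx B /\ forall M, mx_exact M A B.
Proof.
move=> AB exAB [Y AYA].
have [|W WE] := @mx_exact_mul _ _ _ _ A B (1%:M - Y *m A) exAB.
  by rewrite mulmxBr mulmx1 mulmxA AYA subrr.
split=> [|M v Av].
  by exists W; rewrite -WE mulmxBl mul1mx -mulmxA AB mulmx0 subr0.
exists (mact W v).
by rewrite -mactM -WE mactBl mact1 mactM Av mact_at0 subr0.
Qed.

(** Exactness is applied to the left module Q presented by the rows of A and
to the tautological column of the classes of the basis vectors, which A kills.
It reads 1 = B W + C A, and multiplying by A on the left gives A = A C A. *)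
Lemma exact_regular_mx p q r (A : 'M[R]_(p, q)) (B : 'M[R]_(q, r)) :
  A *m B = 0 -> (forall M, fin_gen M -> mx_exact M A B) -> regular_mx A.
Proof.
move=> AB exAB; pose rowA (i : 'I_p) : 'I_q -> R^o := fun j => A i j.
have [Q [f [fs fE]]] :=
  quotient_ex (range_submodule (lcomb rowA : {linear _ -> _})).
have fgQ : fin_gen Q := fin_gen_image fs (@fin_gen_free _ _).
have [|w wE] := exAB Q fgQ (f \o @ebase R q).
  rewrite mact_comp; apply/funext => i; apply/fE.
  by exists (ebase R i); rewrite /= lcomb_ebase -[LHS]lcomb_id.
have [W WE] := comp_surj w fs.
have /choice[C CE] j :
    exists c : 'I_p -> R^o, lcomb rowA c = ebase R j - mact B W j.
  apply/fE; rewrite linearB.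
  have /funeqP/(_ j) /= <- := wE.
  by rewrite -WE mact_comp /= subrr.
pose CM := \matrix_(j, i) (C j i : R).
pose WM := \matrix_(k, j) (W k j : R).
have id1 : 1%:M - B *m WM = CM *m A.
  apply/matrixP => j l; rewrite !mxE.
  have /funeqP/(_ l) := CE j.
  rewrite /lcomb /mact /= fct_sumE /= => h.
  transitivity (\sum_i (C j i : R) * A i l); last first.
    by apply: eq_bigr => i _; rewrite mxE.
  rewrite [RHS]h /ebase; congr (_ - _); rewrite fct_sumE.
  by apply: eq_bigr => k _; rewrite mxE.
by exists CM; rewrite -mulmxA -id1 mulmxBr mulmx1 mulmxA AB mul0mx subr0.
Qed.

Lemma mx_exact_retract M N p q r (A : 'M[R]_(p, q)) (B : 'M[R]_(q, r))
    (s : {linear M -> N}) (t : {linear N -> M}) :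
  (forall x, t (s x) = x) -> mx_exact N A B -> mx_exact M A B.
Proof.
move=> ts exN v Av.
have [|w wE] := exN (s \o v); first by rewrite mact_comp; exact: comp_eq0.
by exists (t \o w); rewrite mact_comp wE; apply/funext => i /=.
Qed.

Lemma mx_exact_free k p q r (A : 'M[R]_(p, q)) (B : 'M[R]_(q, r)) :
  mx_exact R^o A B -> mx_exact ('I_k -> R^o) A B.
Proof.
move=> exR v Av.
have /choice[w wE] j : exists w : 'I_r -> R^o, mact B w = fun i => v i j.
  apply: exR; apply/funext => i.
  have /funeqP/(_ i)/funeqP/(_ j) := Av.
  by rewrite /mact fct_sumE.
exists (fun i j => w j i); apply/funext => i; apply/funext => j.
have /funeqP/(_ i) <- := wE j.
by rewrite /mact fct_sumE.
Qed.

Lemma mx_exact_projective P p q r (A : 'M[R]_(p, q)) (B : 'M[R]_(q, r)) :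
  fin_gen P -> projective_module P -> mx_exact R^o A B -> mx_exact P A B.
Proof.
move=> /fin_gen_cover[k [f fs]] Pp exR.
have [s sE] := Pp _ _ f idfun fs.
exact/(mx_exact_retract sE)/mx_exact_free.
Qed.

Lemma mx_exact_iso M N p q r (A : 'M[R]_(p, q)) (B : 'M[R]_(q, r))
    (f : {linear M -> N}) : injective f -> surj f ->
  mx_exact M A B <-> mx_exact N A B.
Proof.
move=> finj fs.
have [g gE] : exists g : {linear N -> M}, forall x, g (f x) = x.
  apply: (factor_surj (f := (idfun : {linear M -> M}))) => // x fx /=.
  by apply: finj; rewrite fx linear0.
have fg y : f (g y) = y by have [x <-] := fs y; rewrite gE.
by split; [exact: (mx_exact_retract fg) | exact: (mx_exact_retract gE)].
Qed.

(** The two pieces of the long exact Tor sequence of 0 -> K -> X -> C -> 0 that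
are used. *)
Section DimensionShift.
Variables (K X C : lmodType R) (k : {linear K -> X}) (c : {linear X -> C}).
Hypotheses (kinj : injective k) (kc : exact k c) (cs : surj c).
Variables (p0 p1 p2 p3 : nat).
Variables (A0 : 'M[R]_(p0, p1)) (A1 : 'M[R]_(p1, p2)) (A2 : 'M[R]_(p2, p3)).

Lemma mx_exact_kernel : A1 *m A2 = 0 ->
  mx_exact X A0 A1 -> mx_exact C A1 A2 -> mx_exact K A0 A1.
Proof.
move=> A12 exX exC v A0v.
have [|w wE] := exX (k \o v); first by rewrite mact_comp; exact: comp_eq0.
have [|u' u'E] := exC (c \o w).
  by rewrite mact_comp wE; apply/funext => i; exact: exact_comp0.
have [u uE] := comp_surj u' cs.
have [|z zE] := comp_exact (v := w - mact A2 u) kc.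
  apply/funext => i /=; rewrite linearB; apply/eqP; rewrite subr_eq0; apply/eqP.
  have /funeqP/(_ i) /= <- := u'E.
  by rewrite -uE mact_comp.
exists z; apply/eqP; rewrite -subr_eq0; apply/eqP; apply: (comp_inj0 kinj).
apply/funext => i /=; rewrite linearB; apply/eqP.
rewrite subr_eq0; apply/eqP.
have := mact_comp k A1 z => /funeqP/(_ i) /= <-; rewrite zE.
rewrite mactBr -mactM A12 mact0 subr0.
by rewrite wE.
Qed.

Lemma mx_exact_cokernel : A0 *m A1 = 0 ->
  mx_exact K A0 A1 -> mx_exact X A1 A2 -> mx_exact C A1 A2.
Proof.
move=> A01 exK exX v A1v.
have [v' v'E] := comp_surj v cs.
have [|z zE] := comp_exact (v := mact A1 v') kc.
  by rewrite -mact_comp v'E.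
have [|y yE] := exK z.
  by apply: (comp_inj0 kinj); rewrite -mact_comp zE -mactM A01 mact0.
have [|u uE] := exX (v' - (k \o y)).
  by rewrite mactBr mact_comp yE zE subrr.
exists (c \o u); rewrite mact_comp uE; apply/funext => i /=.
rewrite linearB (exact_comp0 _ kc) subr0.
by have /funeqP/(_ i) := v'E.
Qed.

End DimensionShift.

End MatrixAction.

(** * Vanishing of Tor against infinity-syzygy modules *)

Section FreeComplex.
Variables (R : pzRingType) (p : nat -> nat) (A : forall i, 'M[R]_(p i, p i.+1)).
Hypothesis AA : forall i, A i *m A i.+1 = 0.
Hypothesis exactR : forall i, mx_exact R^o (A i) (A i.+1).
Implicit Types C M : lmodType R.

(** With N the cokernel of A 0 acting on columns over R, this is the vanishing
of Tor_(j+1)(N, M). *)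
Definition tor_zero M j := mx_exact M (A j) (A j.+1).

(** Once a syzygy of N is projective, so are all the later ones, and the Tor
of N vanish beyond that degree. *)
Lemma regular_tor_zero k j : regular_mx (A k) -> (k <= j)%N ->
  regular_mx (A j) /\ forall M, tor_zero M j.
Proof.
move=> Ak kj; have Aj : regular_mx (A j).
  rewrite -(subnKC kj); elim: (j - k)%N => [|i IH]; first by rewrite addn0.
  by rewrite addnS; have [] := regular_mx_exact (AA _) (@exactR _) IH.
by split=> // M; have [_ ] := regular_mx_exact (AA _) (@exactR _) Aj; apply.
Qed.

Lemma finite_resolution0 (X : nat -> lmodType R)
    (d : forall i, {linear X i.+1 -> X i}) C (e : {linear X 0%N -> C}) :
  finite_resolution 0 d e -> injective e /\ surj e.
Proof.
move=> [es de _ X0]; split=> //; apply: linear_inj0 => x /de[y <-].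
by rewrite (X0 1%N _ y) // linear0.
Qed.

Lemma finite_resolution_tail m (X : nat -> lmodType R)
    (d : forall i, {linear X i.+1 -> X i}) C (e : {linear X 0%N -> C}) :
  finite_resolution m.+1 d e ->
  exists (K : lmodType R) (k : {linear K -> X 0%N}) (e' : {linear X 1%N -> K}),
    [/\ injective k, exact k e, surj e &
        @finite_resolution R m (fun i => X i.+1) (fun i => d i.+1) K e'].
Proof.
move=> [es de dd X0]; have res : resolution d e by [].
have [K [k [e' [kinj ke _ [e's de' dd']]]]] := resolution_tail res.
by exists K, k, e'; split=> //; split=> // i mi; apply: X0.
Qed.

(** Dimension shifting: Tor_(j+1)(N, X m) embeds in Tor_(j+1+m)(N, C). *)
Lemma tor_zero_syzygy m (X : nat -> lmodType R)
    (d : forall i, {linear X i.+1 -> X i}) C (e : {linear X 0%N -> C}) j :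
  finite_resolution m d e ->
  (forall i, (i < m)%N -> fin_gen (X i) /\ projective_module (X i)) ->
  tor_zero C (j + m) -> tor_zero (X m) j.
Proof.
elim: m X d C e => [|m IH] X d C e fr Xp.
  rewrite addn0; have [einj es] := finite_resolution0 fr.
  exact: (mx_exact_iso _ _ einj es).2.
rewrite addnS => torC.
have [K [k [e' [kinj ke es fr']]]] := finite_resolution_tail fr.
apply: (IH _ _ _ _ fr') => [i im|]; first exact: Xp.
have [fgX0 pX0] := Xp 0%N isT.
apply: (mx_exact_kernel kinj ke es (AA _)) torC.
exact: mx_exact_projective.
Qed.

Lemma tor_zero_resolution m (X : nat -> lmodType R)
    (d : forall i, {linear X i.+1 -> X i}) C (e : {linear X 0%N -> C}) j :
  finite_resolution m d e ->
  (forall i j, (i <= m)%N -> tor_zero (X i) j) ->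
  (m <= j)%N -> tor_zero C j.
Proof.
elim: m X d C e j => [|m IH] X d C e j fr torX mj.
  have [einj es] := finite_resolution0 fr.
  by apply: (mx_exact_iso _ _ einj es).1; exact: torX.
have [K [k [e' [kinj ke es fr']]]] := finite_resolution_tail fr.
case: j mj => // j mj.
apply: (mx_exact_cokernel kinj ke es (AA _)); last exact: torX.
by apply: (IH _ _ _ _ _ fr') => // i l im; exact: torX.
Qed.

(** Write M as a (k+1)-st syzygy: its Tor in every positive degree comes from
one of degree greater than k, where all Tor of N vanish. *)
Lemma tor_zero_infty_syzygy k M j :
  regular_mx (A k) -> infty_syzygy_module M -> tor_zero M j.
Proof.
move=> Ak /(_ k.+1 isT)[_ [C [X [d [e [phi [fr _ [psi phiK psiK] Xp]]]]]]].
have [|_ torC] := @regular_tor_zero k (j + k.+1) Ak.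
  by rewrite addnS leqW // leq_addl.
have torX := tor_zero_syzygy fr Xp (torC C).
apply: (mx_exact_iso _ _ (can_inj phiK) _).2 => // y.
by exists (psi y).
Qed.

Lemma tor_zero_infty_dim k n M j : regular_mx (A k) ->
  infty_syzygy_dim_le M n -> (n <= j)%N -> tor_zero M j.
Proof.
move=> Ak [m mn [X [d [e [fr Xs]]]]] nj.
apply: (tor_zero_resolution fr) (leq_trans mn nj) => i l im.
apply: tor_zero_infty_syzygy Ak _; exact: Xs.
Qed.

Lemma regular_infty_dim k n : regular_mx (A k) ->
  (forall M, fin_gen M -> infty_syzygy_dim_le M n) -> regular_mx (A n).
Proof.
move=> Ak dimn; apply: (exact_regular_mx (AA n)) => M fgM.
exact: (tor_zero_infty_dim Ak (dimn M fgM)).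
Qed.

End FreeComplex.

(** * Right modules and the finitistic dimension *)

Section Converse.
Variable R : pzRingType.

(** Columns over R are right R-modules, and a matrix acts on them by right
R-linear maps; over the converse ring scalars multiply on the other side. *)
Definition cvec p : lmodType R^c := 'I_p -> R^c^o.

Definition cmap p q (A : 'M[R]_(p, q)) (v : cvec q) : cvec p :=
  @mact R R^o p q A v.

Lemma cmap_is_linear p q (A : 'M[R]_(p, q)) : linear (cmap A).
Proof.
move=> a v w; apply/funext => i.
transitivity ((\sum_j A i j * ((v : 'I_q -> R) j)) * (a : R)
  + \sum_j A i j * ((w : 'I_q -> R) j)) => //.
rewrite big_distrl -big_split; apply: eq_bigr => j _ /=.
by rewrite -mulrA -mulrDr.
Qed.

HB.instance Definition _ p q (A : 'M[R]_(p, q)) :=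
  GRing.isLinear.Build R^c (cvec q) (cvec p) *:%R (cmap A) (cmap_is_linear A).

Lemma converse_matrix p q (f : {linear cvec q -> cvec p}) :
  exists A : 'M[R]_(p, q), forall v, f v = cmap A v.
Proof.
exists (\matrix_(i, j) (f (@ebase R^c q j) i : R)) => v.
rewrite [LHS](linear_lcomb f); apply/funext => i.
rewrite /lcomb fct_sumE; apply: eq_bigr => j _.
by rewrite mxE.
Qed.

Lemma cmapM p q r (A : 'M[R]_(p, q)) (B : 'M[R]_(q, r)) v :
  cmap (A *m B) v = cmap A (cmap B v).
Proof. exact: (@mactM R R^o). Qed.

Lemma cmap_inj p q (A B : 'M[R]_(p, q)) : cmap A =1 cmap B -> A = B.
Proof.
move=> AB; apply/matrixP => i j.
have colE (C : 'M[R]_(p, q)) : cmap C (@ebase R^c q j) i = C i j.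
  rewrite /cmap /mact (bigD1 j) //= big1 => [|k kj].
    rewrite addr0; transitivity (C i j * (j == j)%:R) => //.
    by rewrite eqxx mulr1.
  transitivity (C i k * (j == k)%:R) => //.
  by rewrite eq_sym (negPf kj) mulr0.
by rewrite -!colE AB.
Qed.

Lemma cmap_exact p q r (A : 'M[R]_(p, q)) (B : 'M[R]_(q, r)) :
  exact (cmap B : {linear _ -> _}) (cmap A : {linear _ -> _}) <->
  A *m B = 0 /\ mx_exact R^o A B.
Proof.
split=> [ex|[AB ex] v].
  split=> [|v Av]; last by have [w <-] := proj1 (ex v) Av; exists w.
  apply: cmap_inj => v; rewrite cmapM.
  transitivity (0 : cvec p); last by rewrite [RHS](@mact0 R R^o).
  by apply/ex; exists v.
split=> [Av|[w <-] /=]; first by have [w <-] := ex v Av; exists w.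
by rewrite -cmapM AB; exact: (@mact0 R R^o).
Qed.

Lemma cmap_regular p q (A : 'M[R]_(p, q)) :
  regular_map (cmap A : {linear _ -> _}) <-> regular_mx A.
Proof.
split=> [[g gP]|[Y YE]].
  have [Y YE] := converse_matrix g; exists Y; apply: cmap_inj => v.
  by rewrite !cmapM -YE; exact: gP.
by exists (cmap Y) => v /=; rewrite -!cmapM YE.
Qed.

Lemma right_fpd_le_infty_dim n : right_noetherian R ->
  (forall M : lmodType R, fin_gen M -> infty_syzygy_dim_le M n) ->
  right_fpd_le R n.
Proof.
move=> noethR dimn N fgN [k pdN].
have [p0 [f fs]] := fin_gen_cover fgN.
have [p [d [e [ef de dd]]]] := free_resolution noethR f.
have [A AE] : exists A : forall i, 'M[R]_(p i, p i.+1),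
    forall i v, d i v = cmap (A i) v.
  exists (fun i => sval (cid (converse_matrix (d i)))) => i.
  exact: svalP (cid (converse_matrix (d i))).
have res : @resolution R^c (fun i => cvec (p i)) d N e.
  by split=> // y; apply/ef.
have Xp i : projective_module (cvec (p i)) by exact: free_projective.
have Aex i : A i *m A i.+1 = 0 /\ mx_exact R^o (A i) (A i.+1).
  apply/cmap_exact => y; rewrite /= -AE dd.
  by split=> -[x <-]; exists x; rewrite /= AE.
have regE i : regular_map (d i) <-> regular_mx (A i).
  split=> [[g gP]|/cmap_regular[g gP]].
    by apply/cmap_regular; exists g => x; rewrite /= -!AE.
  by exists g => x; rewrite !AE; exact: gP.
apply: (regular_pd_le res Xp); apply/regE.
apply: (regular_infty_dim (fun i => (Aex i).1) (fun i => (Aex i).2)) dimn.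
exact/regE/(pd_le_regular res Xp pdN).
Qed.

End Converse.

(** * Splitting of a dual complex *)

(** The cokernel Q of d n has the C i as a projective resolution of length
n+1 ([up]), so its projective dimension is at most n.  Passing back through the
cokernels of d (n-1), ..., d 0 lowers this bound by one each time ([down]), and
the cokernel of d 0 is projective. *)
Lemma coresolution_split (S : pzRingType) n (C : nat -> lmodType S)
    (d : forall i, {linear C i -> C i.+1}) :
  left_noetherian S -> fpd_le S n ->
  (forall i, fin_gen (C i)) -> (forall i, projective_module (C i)) ->
  injective (d 0%N) -> (forall i, (i < n)%N -> exact (d i) (d i.+1)) ->
  exists g : {linear C 1%N -> C 0%N}, forall x, g (d 0%N x) = x.
Proof.
move=> noethS fpdn fgC pC dinj dd.
have coker i : exists (Q : lmodType S) (q : {linear C i.+1 -> Q}),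
    surj q /\ exact (d i) q by exact: (quotient_ex (range_submodule (d i))).
have coker_inj i (Q : lmodType S) (q : {linear C i.+1 -> Q}) :
    (i < n)%N -> surj q -> exact (d i) q ->
    exists k : {linear Q -> C i.+2}, [/\ injective k, forall x, k (q x) = d i.+1 x &
      forall (N : lmodType S) (r : {linear C i.+2 -> N}),
        exact (d i.+1) r -> exact k r].
  move=> ltin qs dq.
  have [x /dq[y <-]|k kE] := factor_surj (f := d i.+1) qs.
    exact: exact_comp0 (dd i ltin).
  exists k; split=> // [|N r dr y].
    apply: linear_inj0 => u; have [x <-] := qs u; rewrite kE => /(dd i ltin).
    by move/dq.
  rewrite dr; split=> [[x <-]|[u <-]]; first by exists (q x).
  by have [x <-] := qs u; exists x.
have up i (Q : lmodType S) (q : {linear C i.+1 -> Q}) :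
    (i <= n)%N -> surj q -> exact (d i) q -> pd_le Q i.+1.
  elim: i Q q => [|i IH] Q q ltin qs dq.
    exact: (pd_le_extension dinj dq qs (pC 1%N) (projective_pd_le0 (pC 0%N))).
  have [Q' [q' [q's dq']]] := coker i.
  have [k [kinj kE kex]] := coker_inj i Q' q' ltin q's dq'.
  apply: (pd_le_extension kinj (kex _ _ dq) qs (pC _)).
  apply: IH q's dq'; exact: ltnW.
have down i j (Q : lmodType S) (q : {linear C i.+1 -> Q}) :
    (i + j = n)%N -> surj q -> exact (d i) q -> pd_le Q i.
  elim: j i Q q => [|j IH] i Q q ijn qs dq.
    move: ijn; rewrite addn0 => ijn; rewrite ijn; apply: fpdn.
      exact: fin_gen_image qs (fgC _).
    by exists i.+1; apply: up qs dq; rewrite ijn.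
  have ltin : (i < n)%N by rewrite -ijn -addSnnS leq_addr.
  have [k [kinj kE kex]] := coker_inj i Q q ltin qs dq.
  have [Q' [q' [q's dq']]] := coker i.+1.
  apply: (pd_le_kernel noethS _ (pC i.+2) kinj (kex _ _ dq') q's).
    exact: fin_gen_image qs (fgC _).
  by apply: (IH i.+1) q's dq'; rewrite addSnnS.
have [Q [q [qs dq]]] := coker 0%N.
have pdQ := down 0%N n Q q (add0n n) qs dq.
have /pd_leP[X [f [e [res pX _]]]] := projective_pd_le0 (pC 0%N).
have pX' i : projective_module (splice_obj (C 1%N) X i).
  by case: i => [|i]; [exact: pC | exact: pX].
have [g gE] := pd_le_regular (splice_resolution dinj dq qs res) pX' pdQ.
have [es _ _] := res.
exists (e \o g : {linear C 1%N -> C 0%N}) => x.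
have [y <-] := es x.
apply: dinj; exact: gE.
Qed.

(** * Exactness with injective coefficients *)

Section Transpose.
Variable R : pzRingType.
Implicit Types E M N : lmodType R.

(** Maps from a free module to M are columns over M, and precomposing with f is
the action of a matrix: this is Hom(-, M) applied to f. *)
Lemma transpose_matrix p q (f : {linear ('I_q -> R^o) -> ('I_p -> R^o)}) :
  exists A : 'M[R]_(q, p), forall M (w : 'I_p -> M) y,
    lcomb w (f y) = lcomb (mact A w) y.
Proof.
exists (\matrix_(l, j) f (@ebase R q l) j) => M w y.
rewrite [LHS](linear_lcomb ((lcomb w : {linear _ -> _}) \o f)).
apply: eq_bigr => l _; congr (_ *: _); apply: eq_bigr => j _.
by rewrite mxE.
Qed.

Lemma lcomb_inj M p (w w' : 'I_p -> M) : lcomb w =1 lcomb w' -> w = w'.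
Proof. by move=> ww; apply/funext => i; rewrite -(lcomb_ebase w i) ww lcomb_ebase. Qed.

Lemma lcomb0 M p (y : 'I_p -> R^o) : lcomb (0 : 'I_p -> M) y = 0.
Proof. by rewrite /lcomb big1 // => i _; rewrite scaler0. Qed.

Lemma lcomb_comp M N p (f : {linear M -> N}) (w : 'I_p -> M) y :
  f (lcomb w y) = lcomb (f \o w) y.
Proof. by rewrite /lcomb linear_sum; apply: eq_bigr => i _; rewrite linearZ. Qed.

(** Hom(-, E) preserves exactness when E is injective. *)
Lemma mx_exact_injective E p q (A : 'M[R]_(q, p))
    r (A' : 'M[R]_(r, q))
    (f : {linear ('I_q -> R^o) -> ('I_p -> R^o)})
    (f' : {linear ('I_r -> R^o) -> ('I_q -> R^o)}) :
  (forall w y, lcomb w (f y) = lcomb (mact A w) y :> E) ->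
  (forall w y, lcomb w (f' y) = lcomb (mact A' w) y :> E) ->
  injective_module E -> exact f' f -> mx_exact E A' A.
Proof.
move=> fE f'E injE f'f v A'v.
have [y /f'f[z <-]|h hE] := injective_extend (b := f) (f := lcomb v) injE.
  by rewrite /= f'E A'v lcomb0.
exists (h \o @ebase R p); apply: lcomb_inj => y.
by rewrite -fE -lcomb_comp lcomb_id hE.
Qed.

End Transpose.

(** Dimension shifting along the injective coresolution of M, with columns of
cocycles of I in place of the cosyzygy modules.  The ranks start with r 0 = 0, so
that degree 0 of the complex, where exactness is injectivity, needs no separate
statement. *)
Section InjectiveChase.
Variables (R : pzRingType) (n : nat).
Variables (r : nat -> nat) (A : forall i, 'M[R]_(r i.+1, r i)).
Variables (I : nat -> lmodType R) (M : lmodType R) (e : {linear M -> I 0%N}).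
Variable d : forall i, {linear I i -> I i.+1}.
Hypothesis r0 : r 0%N = 0%N.
Hypothesis AA : forall i, A i.+1 *m A i = 0.
Hypothesis exactI : forall i j, (j <= n)%N -> mx_exact (I j) (A i.+1) (A i).
Hypotheses (einj : injective e) (ed : exact e (d 0%N)).
Hypothesis dd : forall i, exact (d i) (d i.+1).

Lemma cycles_exact i j (v : 'I_(r i.+1) -> I j) : (i + j <= n)%N ->
  d j \o v = 0 -> mact (A i.+1) v = 0 ->
  exists2 w, d j \o w = 0 & mact (A i) w = v.
Proof.
elim: i j v => [|i IH] j v ijn dv Av.
  have [//|w wE] := exactI _ Av.
  by exists w => //; apply/funext => -[l lt]; exfalso; rewrite r0 in lt.
have jn : (j <= n)%N := leq_trans (leq_addl _ _) ijn.
have [w' w'E] := exactI jn Av.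
have [|||u du uE] := IH j.+1 (d j \o w').
- by rewrite addnS.
- by apply/funext => l; exact: exact_comp0.
- by rewrite mact_comp w'E.
have [u' u'E] := comp_exact (@dd j) du.
exists (w' - mact (A i) u'); last first.
  by rewrite mactBr -mactM AA mact0 subr0.
apply/funext => l /=; rewrite linearB; apply/eqP; rewrite subr_eq0; apply/eqP.
have /funeqP/(_ l) /= <- := uE.
by rewrite -u'E mact_comp.
Qed.

Lemma mx_exact_coaugmented i : (i <= n)%N -> mx_exact M (A i.+1) (A i).
Proof.
move=> lein v Av.
have [|||w dw wE] := @cycles_exact i 0%N (e \o v).
- by rewrite addn0.
- by apply/funext => l; exact: exact_comp0.
- by rewrite mact_comp; exact: comp_eq0.
have [u uE] := comp_exact ed dw.
exists u; apply/funext => l; apply: einj.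
have /funeqP/(_ l) /= <- := wE.
by rewrite -uE mact_comp.
Qed.

End InjectiveChase.

(** The maps f : R^(p 0) -> M with image Rx and D i form a free resolution of
Rx.  Its transposed matrices satisfy the exactness needed for
[coresolution_split], which yields B with B A_0 = 1; as f D_0 = 0, the column w
of f satisfies A_0 w = 0, so w = B A_0 w = 0 and f = 0. *)
Lemma detects_nonzero (R : pzRingType) n (I : nat -> lmodType R)
    (e : {linear R^o -> I 0%N}) (d : forall i, {linear I i -> I i.+1})
    (M : lmodType R) (x : M) :
  left_noetherian R -> right_noetherian R -> right_fpd_le R n ->
  (forall i, injective_module (I i)) -> injective e -> exact e (d 0%N) ->
  (forall i, exact (d i) (d i.+1)) ->
  (forall j (h : {linear M -> I j}), (j <= n)%N -> h x = 0) -> x = 0.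
Proof.
move=> noethL noethR fpdn injI einj ed dd hx.
have [p [D [f [fE Df DD]]]] :=
  free_resolution noethL (lcomb (fun _ : 'I_1 => x) : {linear _ -> _}).
have fx y : exists a : R, f y = a *: x.
  have [z <-] : exists z, lcomb (fun _ : 'I_1 => x) z = f y.
    by apply/fE; exists y.
  by exists (z ord0); rewrite /lcomb big_ord1.
have [A0 A0E] : exists A0 : forall i, 'M[R]_(p i.+1, p i),
    forall i (N : lmodType R) (w : 'I_(p i) -> N) y,
      lcomb w (D i y) = lcomb (mact (A0 i) w) y.
  exists (fun i => sval (cid (transpose_matrix (D i)))) => i.
  exact: svalP (cid (transpose_matrix (D i))).
(* The dual complex is preceded by a zero module. *)
pose r i := if i is j.+1 then p j else 0%N.
pose A i : 'M[R]_(r i.+1, r i) := if i is j.+1 then A0 j else 0.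
have AA i : A i.+1 *m A i = 0.
  case: i => [|i] /=; first by rewrite mulmx0.
  apply: cmap_inj => v; rewrite cmapM [RHS](@mact0 R R^o).
  apply: (@lcomb_inj R R^o) => y.
  by rewrite -[LHS]A0E -[LHS]A0E (exact_comp0 _ (DD i)) linear0 lcomb0.
have exI i j : (j <= n)%N -> mx_exact (I j) (A i.+1) (A i).
  move=> lejn; case: i => [|i] /=; last first.
    exact: (mx_exact_injective (A0E i _) (A0E i.+1 _) (injI j) (DD i)).
  (* In degree 0, v extends to a map from M to I j, which kills x. *)
  move=> v Av; exists 0; rewrite mact0; apply: lcomb_inj => y; rewrite lcomb0.
  have [z /Df[u <-]|h hE] := injective_extend (b := f) (f := lcomb v) (injI j).
    by rewrite /= A0E Av lcomb0.
  by rewrite -[RHS]hE; have [a ->] := fx y; rewrite linearZ /= (hx j h lejn) scaler0.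
have exR i : (i <= n)%N -> mx_exact R^o (A i.+1) (A i).
  exact: (mx_exact_coaugmented (erefl _) AA exI einj ed dd).
have [g gE] : exists g : {linear cvec R (p 1%N) -> cvec R (p 0%N)},
    forall v, g (cmap (A0 0%N) v) = v.
  apply: (@coresolution_split R^c n (fun i => cvec R (p i))
    (fun i => cmap (A0 i)) noethR fpdn).
  - by move=> i; exact: fin_gen_free.
  - by move=> i; exact: free_projective.
  - apply: linear_inj0 => v Av; have [w <-] := exR 0%N (leq0n n) v Av.
    exact: (@mact0 R R^o).
  - by move=> i ltin; apply/cmap_exact; split; [exact: (AA i.+1) | exact: (exR i.+1)].
have [B BE] := converse_matrix g.
have BA : B *m A0 0%N = 1%:M.
  by apply: cmap_inj => v; rewrite cmapM -BE gE [RHS](@mact1 R R^o).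
pose w := f \o @ebase R (p 0%N).
have fw y : f y = lcomb w y by rewrite [LHS]linear_lcomb.
have w0 : w = 0.
  rewrite -[w]mact1 -BA mactM -[RHS](mact_at0 _ B); congr (mact B _).
  apply: lcomb_inj => y; rewrite -A0E -fw (exact_comp0 _ Df) lcomb0 //.
have [y <-] : exists y, f y = x.
  apply/fE; exists (fun=> 1); rewrite /= /lcomb big_ord1; exact: scale1r.
by rewrite fw w0 lcomb0.
Qed.

(** * Finite sums of injectives and cogenerators *)

Section FiniteSum.
Variable S : pzRingType.
Implicit Types A B E F M X : lmodType S.

Lemma injective_prod E F : injective_module E -> injective_module F ->
  injective_module (E * F)%type.
Proof.
move=> injE injF A B i f iinj.
have lin1 : linear (fun x => (f x).1) by move=> a x y; rewrite linearP.
have lin2 : linear (fun x => (f x).2) by move=> a x y; rewrite linearP.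
have [f1 f1E] := linear_map_ex lin1; have [f2 f2E] := linear_map_ex lin2.
have [h1 h1E] := injE _ _ i f1 iinj; have [h2 h2E] := injF _ _ i f2 iinj.
have lin : linear (fun y => (h1 y, h2 y)) by move=> a x y; rewrite !linearP.
have [h hE] := linear_map_ex lin.
by exists h => x; rewrite hE h1E h2E f1E f2E; case: (f x).
Qed.

Lemma injective_dsum (I : nat -> lmodType S) n :
  (forall i, injective_module (I i)) -> injective_module (dsum I n).
Proof.
move=> injI; elim: n => [|n IH]; first exact: injI.
exact: injective_prod.
Qed.

Lemma dsum_inclusion (I : nat -> lmodType S) n j : (j <= n)%N ->
  exists k : {linear I j -> dsum I n}, injective k.
Proof.
elim: n => [|n IH]; first by rewrite leqn0 => /eqP ->; exists idfun.
rewrite leq_eqVlt => /orP[/eqP ->|/IH[k kinj]].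
  have lin : linear (fun y : I n.+1 => (0, y) : dsum I n.+1).
    move=> a x y; transitivity (a *: 0 + 0 : dsum I n, a *: x + y) => //.
    by rewrite scaler0 addr0.
  have [k kE] := linear_map_ex lin.
  by exists k => x y; rewrite !kE => -[].
have lin : linear (fun y : I j => (k y, 0) : dsum I n.+1).
  move=> a x y; rewrite linearP.
  transitivity (a *: k x + k y, a *: 0 + 0 : I n.+1) => //.
  by rewrite scaler0 addr0.
have [k' k'E] := linear_map_ex lin.
by exists k' => x y; rewrite !k'E => -[/kinj].
Qed.

(** The copies of X are indexed by the elements of M: for each
nonzero x, one map that does not kill x is chosen. *)
Lemma injective_cogeneratorP X : injective_module X ->
  (forall M (x : M), (forall h : {linear M -> X}, h x = 0) -> x = 0) ->
  injective_cogenerator X.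
Proof.
move=> injX detX; split=> // M.
have /choice[h hP] x : exists g : {linear M -> X}, g x = 0 -> x = 0.
  have [x0|/existsNP[g gx]] := pselect (forall g : {linear M -> X}, g x = 0).
    by exists \0 => _; exact: detX.
  by exists g.
have lin : linear (fun m => (fun x => h x m) : M -> X).
  by move=> a x y; apply/funext => z; rewrite linearP.
have [f fE] := linear_map_ex lin.
exists M, f; apply: linear_inj0 => x; rewrite fE => /funeqP/(_ x).
exact: hP.
Qed.

End FiniteSum.

(** * The theorem *)

Theorem proposition3p10 (R : pzRingType) (n : nat)
    (hl : left_noetherian R) (hr : right_noetherian R)
    (hdim : forall M : lmodType R, fin_gen M -> infty_syzygy_dim_le M n) :
  right_fpd_le R n /\
  forall (I : nat -> lmodType R) (e : {linear R^o -> I 0%N})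
         (d : forall i, {linear I i -> I i.+1}),
    minimal_injective_resolution e d -> injective_cogenerator (dsum I n).
Proof.
have fpdn := right_fpd_le_infty_dim hr hdim.
split=> // I e d [injI einj ed dd _].
apply: injective_cogeneratorP; first exact: injective_dsum.
move=> M x hx; apply: (detects_nonzero hl hr fpdn injI einj ed dd) => j h lejn.
have [k kinj] := dsum_inclusion I lejn.
by apply: kinj; rewrite linear0; exact: (hx (k \o h)).
Qed.
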